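(* Let $M$ be a rationally supported submonoid of $(\mathbb{Z}^2,+)$. Then $M$ is a Furstenberg monoid.
   Context: Let $M$ be a submonoid of $(\mathbb{Z}^2,+)$. $\mathcal{U}(M)$ denotes the group of invertible elements of $M$. An element $a\in M\setminus\mathcal{U}(M)$ is an atom if whenever $a=r+s$ with $r,s\in M$, either $r\in\mathcal{U}(M)$ or $s\in\mathcal{U}(M)$. For $r,s\in M$, $s$ divides $r$ in $M$ if $r=s+t$ for some $t\in M$. $M$ is a Furstenberg monoid if every element of $M\setminus\mathcal{U}(M)$ is divisible in $M$ by an atom of $M$. A supporting line of $M$ is a line through the origin of $\mathbb{R}^2$ such that $M$ is contained in one of the two closed half-planes determined by that line. $M$ is rationally supported if it has a supporting line with rational slope. *)

(* Defs.v *)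
From mathcomp Require Import all_boot all_order all_algebra.
From mathcomp Require Import reals.
Set Implicit Arguments.
Unset Strict Implicit.
Unset Printing Implicit Defensive.
Import Order.TTheory GRing.Theory Num.Theory.
Local Open Scope ring_scope.

Section Monoids.
Variables (V : zmodType) (M : {pred V}).

Definition invertible_in (u : V) : Prop :=
  u \in M /\ exists2 v, v \in M & u + v = 0.

Definition divides_in (s r : V) : Prop := exists2 t, t \in M & r = s + t.

Definition atom_in (a : V) : Prop :=
  [/\ a \in M, ~ invertible_in a &
      forall r s, r \in M -> s \in M -> a = r + s ->
        invertible_in r \/ invertible_in s].

Definition furstenberg : Prop :=
  forall x, x \in M -> ~ invertible_in x ->
    exists2 a, atom_in a & divides_in a x.

End Monoids.

Section SupportingLines.
Variable R : realType.

(* A line through the origin of R^2 is encoded by a nonzero direction vector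
   d; [line_form d p] is det(d, p), which vanishes exactly on the line and
   whose sign separates the two half-planes it bounds. *)
Definition line_form (d p : R * R) : R := d.1 * p.2 - d.2 * p.1.

Definition real_point (p : int * int) : R * R := (p.1%:~R, p.2%:~R).

Definition supporting_line (M : {pred int * int}) (d : R * R) : Prop :=
  d != 0 /\
  ((forall p, p \in M -> 0 <= line_form d (real_point p)) \/
   (forall p, p \in M -> line_form d (real_point p) <= 0)).

(* Vertical lines count as having rational slope (slope 1/0), so this says
   that the line is spanned by a vector with rational coordinates. *)
Definition rational_slope (d : R * R) : Prop :=
  d.1 = 0 \/ (d.1 != 0 /\ exists q : rat, d.2 / d.1 = ratr q).

Definition rationally_supported (M : {pred int * int}) : Prop :=
  exists2 d, supporting_line M d & rational_slope d.

End SupportingLines.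

(* Main.v *)
Require Import Defs.
From HB Require Import structures.
From mathcomp Require Import all_boot all_order all_algebra.
From mathcomp Require Import reals boolp.
From mathcomp Require Import ring zify.
Set Implicit Arguments.
Unset Strict Implicit.
Unset Printing Implicit Defensive.
Import Order.TTheory GRing.Theory Num.Theory.
Local Open Scope ring_scope.

(** Atoms are found by descent: if an integer-valued additive function is
    positive on every non-invertible divisor of x, splitting x repeatedly into
    non-invertible summands must stop, and it stops at an atom dividing x
    ([descent_to_atom]).

    Rational slope lets the supporting line be cut out by an integral form f
    with f >= 0 on M ([rationally_supported_det]).  If all non-invertible
    divisors of x have f > 0, descend along f.  Otherwise x has a
    non-invertible divisor y on the line f = 0, and it is enough to find an
    atom dividing y.  All divisors of y lie on that line, where points are
    determined by a second integral form g; as M meets the line in a rank-one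
    monoid which is not a group, g has constant sign there, so one can descend
    along g, suitably oriented. *)

Section Divisibility.
Variables (V : zmodType) (M : {pred V}).
Hypothesis M_closed : addr_closed M.

Lemma closedMn x n : x \in M -> x *+ n \in M.
Proof.
move=> xM; elim: n => [|n IHn]; first by rewrite mulr0n; case: M_closed.
by rewrite mulrS; apply: M_closed.2.
Qed.

Lemma invertible_in0 : invertible_in M 0.
Proof. by case: M_closed => M0 _; split=> //; exists 0; rewrite ?addr0. Qed.

Lemma divides_in_trans y x z :
  divides_in M x y -> divides_in M y z -> divides_in M x z.
Proof.
move=> [s sM ->] [t tM ->]; exists (s + t); last by rewrite addrA.
exact: M_closed.2.
Qed.

Lemma non_atom_split x : x \in M -> ~ invertible_in M x -> ~ atom_in M x ->
  exists r s, [/\ r \in M, s \in M, x = r + s,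
                  ~ invertible_in M r & ~ invertible_in M s].
Proof.
move=> xM xU xA; apply: contrapT => no_split; apply: xA; split=> // r s rM sM xrs.
apply: contrapT => /not_orP[rU sU]; apply: no_split.
by exists r, s.
Qed.

(** Both summands of a splitting of x divide x, so the additive h is positive
    on both and each has a smaller h-value than x; the hypothesis passes to the
    summands by transitivity of divisibility, so the induction applies. *)
Lemma descent_to_atom (h : {additive V -> int}) x :
    x \in M -> ~ invertible_in M x ->
    (forall r, r \in M -> ~ invertible_in M r -> divides_in M r x -> 0 < h r) ->
  exists2 a, atom_in M a & divides_in M a x.
Proof.
have [n] := ubnP `|h x|%N; elim: n => // n IHn in x *.
move=> hxn xM xU h_gt0.
have [xA|xA] := EM (atom_in M x).
  by exists x => //; exists 0; rewrite ?addr0 //; case: M_closed.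
have [r [s [rM sM xrs rU sU]]] := non_atom_split xM xU xA.
have rx : divides_in M r x by exists s.
have sx : divides_in M s x by exists r; rewrite // addrC.
have hr := h_gt0 r rM rU rx; have hs := h_gt0 s sM sU sx.
have hx : h x = h r + h s by rewrite xrs raddfD.
have [|//|//||a aA ar] := IHn r; first by lia.
  by move=> t tM tU tr; apply: h_gt0 => //; apply: divides_in_trans rx.
by exists a => //; apply: divides_in_trans rx.
Qed.

Section TwoForms.
Variables f g : {additive V -> int}.
Hypothesis f_ge0 : forall p, p \in M -> 0 <= f p.
Hypothesis fg_inj : forall p, f p = 0 -> g p = 0 -> p = 0.

Lemma divides_in_ker y r :
  f y = 0 -> r \in M -> divides_in M r y -> f r = 0.
Proof.
move=> fy rM [t tM yrt]; have := f_ge0 rM; have := f_ge0 tM.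
by move: fy; rewrite yrt raddfD /=; lia.
Qed.

(** If g y and g r had opposite signs, some combination m y + n r with m, n > 0
    would vanish under both forms, hence be 0, and -y = (m - 1) y + n r would
    lie in M. *)
Lemma same_side_in_ker y r : y \in M -> ~ invertible_in M y -> f y = 0 ->
    r \in M -> f r = 0 -> 0 <= g y * g r.
Proof.
move=> yM yU fy rM fr; rewrite leNgt; apply/negP; rewrite mulr_lt0.
move=> /and3P[gy0 gr0 opposite]; apply: yU.
have comb0 : y *+ `|g r| + r *+ `|g y| = 0.
  apply: fg_inj; rewrite raddfD !raddfMn /= ?fy ?fr ?mul0rn ?addr0 //.
  rewrite -[g y *+ _]mulr_natr -[g r *+ _]mulr_natr !natz !abszE.
  case: (ltrgt0P (g y)) gy0 opposite => // _ _;
    by case: (ltrgt0P (g r)) gr0 => // _ _ _; ring.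
split=> //; exists (y *+ `|g r|.-1 + r *+ `|g y|).
  by apply: M_closed.2; apply: closedMn.
by rewrite addrA -mulrS prednK // absz_gt0.
Qed.

Lemma furstenberg_two_forms : furstenberg M.
Proof.
move=> x xM xU.
have [[y [yM yU yx fy]]|no_ker] := EM (exists y,
    [/\ y \in M, ~ invertible_in M y, divides_in M y x & f y = 0]); last first.
  apply: (@descent_to_atom f) => // r rM rU rx.
  rewrite lt_def f_ge0 // andbT; apply/eqP => fr; apply: no_ker.
  by exists r.
have nz r : ~ invertible_in M r -> f r = 0 -> g r != 0.
  move=> rU fr; apply/eqP => gr; apply: rU.
  by rewrite (fg_inj fr gr); apply: invertible_in0.
suff [a aA ay] : exists2 a, atom_in M a & divides_in M a y.
  by exists a => //; apply: divides_in_trans yx.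
(* Multiplying by g y orients g so that it is nonnegative on the line. *)
apply: (descent_to_atom (h := g y \*o g)) => // r rM rU ry /=.
have fr := divides_in_ker fy rM ry.
by rewrite lt_def mulf_neq0 ?nz //= same_side_in_ker.
Qed.

End TwoForms.
End Divisibility.

Definition det_form (d p : int * int) : int := d.1 * p.2 - d.2 * p.1.
Definition dot_form (d p : int * int) : int := d.1 * p.1 + d.2 * p.2.

Fact det_form_is_additive d : zmod_morphism (det_form d).
Proof. by move=> p q; rewrite /det_form /=; ring. Qed.
HB.instance Definition _ d :=
  GRing.isZmodMorphism.Build (int * int)%type int (det_form d)
    (det_form_is_additive d).

Fact dot_form_is_additive d : zmod_morphism (dot_form d).
Proof. by move=> p q; rewrite /dot_form /=; ring. Qed.
HB.instance Definition _ d :=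
  GRing.isZmodMorphism.Build (int * int)%type int (dot_form d)
    (dot_form_is_additive d).

(** A nonzero d and its quarter turn span the plane over the rationals. *)
Lemma det_dot_inj d p : d != 0 -> det_form d p = 0 -> dot_form d p = 0 -> p = 0.
Proof.
case: d p => [a b] [x y] d0; rewrite /det_form /dot_form /= => det0 dot0.
have n0 : a ^+ 2 + b ^+ 2 != 0.
  by move: d0; rewrite paddr_eq0 ?sqr_ge0 // !sqrf_eq0.
have x0 : (a ^+ 2 + b ^+ 2) * x = 0.
  transitivity (a * (a * x + b * y) - b * (a * y - b * x)); first by ring.
  by rewrite det0 dot0 !mulr0 subr0.
have y0 : (a ^+ 2 + b ^+ 2) * y = 0.
  transitivity (b * (a * x + b * y) + a * (a * y - b * x)); first by ring.
  by rewrite det0 dot0 !mulr0 addr0.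
move/eqP: x0; move/eqP: y0; rewrite !mulf_eq0 (negbTE n0) /=.
by move=> /eqP-> /eqP->.
Qed.

Section RationalLines.
Variable R : realType.

Lemma rational_slope_integral (d : R * R) : d != 0 -> rational_slope d ->
  exists (c : R) (e : int * int), [/\ c != 0, e != 0 & d = (c * e.1%:~R, c * e.2%:~R)].
Proof.
case: d => a b d0 [/= a0|[/= a0 [q baq]]].
  exists b, (0, 1); rewrite a0 mulr0 mulr1; split=> //.
  by apply: contra_neq d0 => b0; rewrite a0 b0.
have q0 : (denq q)%:~R != 0 :> R by rewrite intr_eq0 denq_neq0.
exists (a / (denq q)%:~R), (denq q, numq q); split.
- by rewrite mulf_neq0 ?invr_eq0.
- by apply: contra_neq (denq_neq0 q) => -[].
- have -> : b = a * (b / a) by field.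
  by rewrite baq /ratr /=; congr (_, _); field.
Qed.

(** The sign of the scaling factor and the choice of half-plane are both
    absorbed into the orientation of the integral direction. *)
Lemma rationally_supported_det (M : {pred int * int}) :
    rationally_supported R M ->
  exists2 e, e != 0 & forall p, p \in M -> 0 <= det_form e p.
Proof.
move=> [d [d0 side] /(rational_slope_integral d0)[c [e [c0 e0 dE]]]].
have lineE p : line_form d (real_point R p) = c * (det_form e p)%:~R.
  by rewrite dE /line_form /det_form /= rmorphB !rmorphM /=; ring.
have detN p : det_form (- e) p = - det_form e p.
  by rewrite /det_form /=; ring.
have Ne0 : - e != 0 by rewrite oppr_eq0.
have [cP|cN] := orP (lt_total c0); case: side => side.
- exists (- e) => // p /side.
  by rewrite lineE nmulr_rge0 // lerz0 detN oppr_ge0.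
- by exists e => // p /side; rewrite lineE nmulr_rle0 // ler0z.
- by exists e => // p /side; rewrite lineE pmulr_rge0 // ler0z.
- exists (- e) => // p /side.
  by rewrite lineE pmulr_rle0 // lerz0 detN oppr_ge0.
Qed.

End RationalLines.

Theorem proposition5p2 (R : realType) (M : {pred int * int})
  (submonM : addr_closed M) (suppM : rationally_supported R M) :
  furstenberg M.
Proof.
have [e e0 det_ge0] := rationally_supported_det suppM.
apply: (furstenberg_two_forms submonM (f := det_form e) (g := dot_form e)) => //.
by move=> p; apply: det_dot_inj.
Qed.
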